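(* Let $H$ be a Hilbert space with inner product $(\cdot,\cdot)$ and let $A$ and $B$ be closed subspaces of $H$. Then $$P_{A\cap B}^\perp a=\sum_{k=0}^\infty\left\{P_B^\perp(P_A^\perp P_B^\perp)^ka-(P_A^\perp P_B^\perp)^{k+1}a\right\},\qquad a\in A,$$ $$(P_{A\cap B}^\perp a_1,P_{A\cap B}^\perp a_2)=\sum_{k=0}^\infty(P_B^\perp(P_A^\perp P_B^\perp)^ka_1,a_2),\qquad a_1,a_2\in A,$$ $$(P_{A\cap B}^\perp a,P_{A\cap B}^\perp b)=-\sum_{k=0}^\infty((P_A^\perp P_B^\perp)^{k+1}a,b),\qquad a\in A,\ b\in B,$$ the sum in the first formula converging strongly (in the norm of $H$).
   Context: For a closed subspace $C$ of $H$, $P_C$ is the orthogonal projection of $H$ onto $C$ and $P_C^\perp=I-P_C$ is the orthogonal projection onto the orthogonal complement $C^\perp$. *)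

(* Defs.v *)
From HB Require Import structures.
From mathcomp Require Import all_boot all_order all_algebra.
From mathcomp Require Import complex.
From mathcomp Require Import all_classical all_reals all_analysis.
Set Implicit Arguments.
Unset Strict Implicit.
Unset Printing Implicit Defensive.
Import Order.TTheory GRing.Theory Num.Theory.
Import numFieldNormedType.Exports.
Local Open Scope classical_set_scope.
Local Open Scope ring_scope.
Local Open Scope complex_scope.

(* The scalar fields of Hilbert spaces, each with its conjugation: the reals
   [R] with the identity, or the complex numbers [R[i]] with [conjC]. *)
Variant real_or_complex (R : realType) :
    forall K : numFieldType, (K -> K) -> Prop :=
  | RealScalars : @real_or_complex R R idfun
  | ComplexScalars : @real_or_complex R R[i] (@Num.conj R[i]).

(* [inner x y] is linear in [x] and [conj]-linear in [y]. *)
Structure hilbert (K : numFieldType) (conj : K -> K) := Hilbert {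
  hilbert_space :> completeNormedModType K ;
  inner : {dot hilbert_space for conj} ;
  inner_normE : forall x : hilbert_space, `|x| ^+ 2 = inner x x
}.

Section Projections.
Context {K : numFieldType} {conj : K -> K} {H : hilbert conj}.
Implicit Types (C : set H) (x : H).

Definition closed_subspace C :=
  submod_closed (mem C : {pred H}) /\ closed C.

(* For a closed subspace [C], exactly one [y] in [C] has [x - y] orthogonal to
   [C]; the default value 0 only matters for other sets [C]. *)
Definition orthoproj C x : H :=
  xget 0 [set y | C y /\ forall z, C z -> inner H (x - y) z = 0].

Definition orthoprojC C x : H := x - orthoproj C x.

End Projections.

(* Main.v *)
(** On [A] the powers of [P_A P_B] describe the partial sums: induction gives
    [P_B^⊥ (P_A^⊥ P_B^⊥)^k a = P_B^⊥ (P_A P_B)^k a] for [a] in [A], so the k-th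
    term [P_A P_B^⊥ (P_A^⊥ P_B^⊥)^k a] equals
    [(P_A P_B)^k a - (P_A P_B)^(k+1) a] and the series telescopes to
    [a - (P_A P_B)^n a].  It remains to prove von Neumann's theorem
    [(P_A P_B)^n a --> P_(A∩B) a].  As [P_A P_B] is a positive self-adjoint
    contraction on [A], the numbers [((P_A P_B)^k a, a)] decrease, which makes
    the iterates Cauchy; their limit is fixed by [P_A P_B], hence lies in both
    [A] and [B]. *)
Require Import Defs.
From mathcomp Require Import all_boot all_order all_algebra.
From mathcomp Require Import complex ring.
From mathcomp Require Import all_classical all_reals all_analysis.
Set Implicit Arguments.
Unset Strict Implicit.
Unset Printing Implicit Defensive.
Import Order.TTheory GRing.Theory Num.Theory.
Import numFieldNormedType.Exports.
Local Open Scope classical_set_scope.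
Local Open Scope ring_scope.

(** * Facts shared by the real and complex scalar fields *)

Section Scalars.
Context {R : realType} {K : numFieldType} {conj : K -> K}.
Hypothesis scalars : @real_or_complex R K conj.

(** Only here and in [scalar_inf_adherent] are the real and the complex case treated separately. *)
Lemma mul_scalar_conj x : x * conj x = `|x| ^+ 2.
Proof.
case: scalars x => x; last by rewrite normCK.
by rewrite real_normK ?num_real // expr2.
Qed.

(** Stands in for an infimum in [K]. A nonnegative element of [R[i]] has zero imaginary part, so the
    complex case follows from infima of real parts. *)
Lemma scalar_inf_adherent (S : set K) (e : K) :
  S !=set0 -> (forall x, S x -> 0 <= x) -> 0 < e ->
  exists2 s, S s & forall t, S t -> s <= t + e.
Proof.
have real_case (T : set R) (d : R) : T !=set0 ->
    (forall x, T x -> 0 <= x) -> 0 < d ->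
    exists2 s, T s & forall t, T t -> s <= t + d.
  move=> T0 Tge0 d0.
  have Tinf : has_inf T by split => //; exists 0.
  have [s Ts slt] := inf_adherent d0 Tinf.
  exists s => // t Tt; rewrite (le_trans (ltW slt)) // lerD2r.
  exact: (ge_inf Tinf.2).
case: scalars S e => // S e [x Sx] Sge0 e0.
have ge0ReIm (z : R[i]) : 0 <= z -> complex.Im z = 0 /\ 0 <= complex.Re z.
  by rewrite lecE => /andP[/eqP-> ->].
have [|||s [z Sz <-] zmin] :=
    real_case [set complex.Re z | z in S] (complex.Re e).
- by exists (complex.Re x), x.
- by move=> _ [z /Sge0 /ge0ReIm[_ z0] <-].
- by move: e0; rewrite ltcE => /andP[].
exists z => // t St.
have [z0 _] := ge0ReIm _ (Sge0 _ Sz); have [t0 _] := ge0ReIm _ (Sge0 _ St).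
have [e0' _] := ge0ReIm _ (ltW e0).
rewrite lecE !raddfD /= z0 t0 e0' addr0 eqxx /=.
by rewrite zmin//; exists t.
Qed.

End Scalars.

(** * Inner product identities, Cauchy-Schwarz and closed subspaces *)

Section InnerProduct.
Context {R : realType} {K : numFieldType} {conj : K -> K}.
Hypothesis scalars : @real_or_complex R K conj.
Variable H : hilbert conj.
Implicit Types (a x y z w : H) (c : K) (C : set H).
Local Notation "'[ x , y ]" := (inner H x y) : ring_scope.

Lemma innerC x y : '[x, y] = conj '[y, x].
Proof. by rewrite (hermitian_subproof (s := inner H)) expr0 mul1r. Qed.

Lemma innerDl x y z : '[x + y, z] = '[x, z] + '[y, z].
Proof. exact: (linearDl (inner H)). Qed.

Lemma innerBl x y z : '[x - y, z] = '[x, z] - '[y, z].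
Proof. exact: (linearBl (inner H)). Qed.

Lemma innerZl c x z : '[c *: x, z] = c * '[x, z].
Proof. exact: (linearZl_LR (inner H)). Qed.

Lemma innerDr x y z : '[x, y + z] = '[x, y] + '[x, z].
Proof. exact: (linearDr (inner H)). Qed.

Lemma innerBr x y z : '[x, y - z] = '[x, y] - '[x, z].
Proof. exact: (linearBr (inner H)). Qed.

Lemma innerZr c x z : '[x, c *: z] = conj c * '[x, z].
Proof. exact: (linearZr_LR (inner H)). Qed.

Lemma inner_normD x y :
  `|x + y| ^+ 2 = `|x| ^+ 2 + ('[x, y] + '[y, x]) + `|y| ^+ 2.
Proof. by rewrite !inner_normE !(innerDl, innerDr); ring. Qed.

Lemma inner_normB x y :
  `|x - y| ^+ 2 = `|x| ^+ 2 - ('[x, y] + '[y, x]) + `|y| ^+ 2.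
Proof. by rewrite !inner_normE !(innerBl, innerBr); ring. Qed.

Lemma inner_mulC x y : '[x, y] * '[y, x] = `|'[x, y]| ^+ 2.
Proof. by rewrite (innerC y x) (mul_scalar_conj scalars). Qed.

Lemma inner_eq0C x y : '[x, y] = 0 -> '[y, x] = 0.
Proof.
move=> xy0; apply/eqP; rewrite -normr_eq0 -sqrf_eq0.
by rewrite -inner_mulC xy0 mulr0.
Qed.

Lemma pythagoras x y : '[x, y] = 0 -> `|x + y| ^+ 2 = `|x| ^+ 2 + `|y| ^+ 2.
Proof. by move=> xy0; rewrite inner_normD xy0 (inner_eq0C xy0) !addr0. Qed.

(* Both Cauchy-Schwarz and the orthogonality of near-minimizers come from the
   minimal distance from [x] to the line spanned by [w]. *)
Lemma norm_sub_inner_scale x w : w != 0 ->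
  `|x - ('[x, w] / `|w| ^+ 2) *: w| ^+ 2
  = `|x| ^+ 2 - `|'[x, w]| ^+ 2 / `|w| ^+ 2.
Proof.
move=> w0; rewrite inner_normE innerBr innerZr [X in _ - _ * X]innerBl.
rewrite innerZl -inner_normE divfK ?subrr ?mulr0 ?subr0; last first.
  by rewrite sqrf_eq0 normr_eq0.
by rewrite innerBl innerZl -inner_normE mulrAC inner_mulC.
Qed.

Lemma cauchy_schwarz x w : `|'[x, w]| <= `|x| * `|w|.
Proof.
have [->|w0] := eqVneq w 0; first by rewrite (linear0r (inner H)) !normr0 mulr0.
rewrite -(@ler_pXn2r _ 2) ?nnegrE ?mulr_ge0// exprMn.
rewrite -ler_pdivrMr ?exprn_gt0 ?normr_gt0// -subr_ge0.
by rewrite -norm_sub_inner_scale// exprn_ge0.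
Qed.

Lemma cvg_innerl (T : Type) (F : set_system T) {FF : Filter F} (u : T -> H) x w :
  u t @[t --> F] --> x -> '[u t, w] @[t --> F] --> '[x, w].
Proof.
move=> /cvgrPdist_lt ux; apply/cvgrPdist_lt => e e0.
(* Adding 1 keeps the divisor positive when [w] is 0. *)
have w0 : 0 < `|w| + 1 by rewrite ltr_wpDl.
near=> t; rewrite -innerBl (le_lt_trans (cauchy_schwarz _ _))//.
rewrite (@le_lt_trans _ _ (`|x - u t| * (`|w| + 1)))//.
  by rewrite ler_wpM2l// lerDl.
by rewrite -ltr_pdivlMr//; near: t; apply: ux; rewrite divr_gt0.
Unshelve. all: by end_near. Qed.

Lemma closed_subspaceD C x y : closed_subspace C -> C x -> C y -> C (x + y).
Proof.
move=> [[_ lin] _] Cx Cy; have := lin 1 x y.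
by rewrite scale1r !inE; apply.
Qed.

Lemma closed_subspaceZ C c x : closed_subspace C -> C x -> C (c *: x).
Proof.
move=> [[C0 lin] _] Cx; have := lin c x 0.
by rewrite addr0 !inE in C0 *; apply.
Qed.

Lemma closed_subspaceB C x y : closed_subspace C -> C x -> C y -> C (x - y).
Proof.
move=> HC Cx Cy; rewrite -scaleN1r.
by apply: closed_subspaceD => //; apply: closed_subspaceZ.
Qed.

Lemma closed_subspaceI C D : closed_subspace C -> closed_subspace D ->
  closed_subspace (C `&` D).
Proof.
move=> HC HD; split; last by apply: closedI; [case: HC|case: HD].
split=> [|a x y]; first by rewrite !inE; case: HC HD => -[+ _] _ [[+ _] _]; rewrite !inE.
rewrite !inE => -[Cx Dx] [Cy Dy]; split.
  by apply: closed_subspaceD => //; apply: closed_subspaceZ.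
by apply: closed_subspaceD => //; apply: closed_subspaceZ.
Qed.

(** * Existence and properties of the orthogonal projection *)

Section Projection.
Variable C : set H.
Hypothesis HC : closed_subspace C.

(* A filter rather than a minimizing sequence, so that no archimedean property
   of [K] is needed. *)
Let near_minimizers x (e : K) : set H :=
  [set y | C y /\ forall z, C z -> `|x - y| ^+ 2 <= `|x - z| ^+ 2 + e].

Let minimizing x : set_system H :=
  filter_from [set e : K | 0 < e] (near_minimizers x).

Let minimizing_filter x : ProperFilter (minimizing x).
Proof.
apply: filter_from_proper => [|e /= e0]; last first.
  have [|||s [y Cy <-] ymin] := scalar_inf_adherent scalars
      (S := [set `|x - z| ^+ 2 | z in C]) (e := e).
  - by exists (`|x - 0| ^+ 2), 0 => //; case: HC => -[+ _] _; rewrite inE.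
  - by move=> _ [z _ <-]; rewrite exprn_ge0.
  - by [].
  - by exists y; split => // z Cz; apply: ymin; exists z.
apply: filter_from_filter => [|d e /= d0 e0]; first by exists 1 => /=.
exists (Num.min d e).
  by rewrite /Order.min; case: ifP.
(* The order of [K] may be partial; [d] and [e] are comparable because both are positive, hence
   real. *)
have de : (d >=< e)%R by rewrite real_comparable ?gtr0_real.
move=> y [Cy ymin]; split; split => // z Cz; apply: le_trans (ymin _ Cz) _.
  by rewrite lerD2l comparable_ge_min// lexx.
by rewrite lerD2l comparable_ge_min// lexx orbT.
Qed.

(** The midpoint of [y] and [z] lies in [C], so the squared distances from [x] to [y] and to [z]
    exceed that to the midpoint by at most [e] each. The parallelogram law turns this into a bound
    on [y - z]. *)
Let near_minimizers_dist x (e : K) y z : near_minimizers x e y ->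
  near_minimizers x e z -> `|y - z| ^+ 2 <= 4 * e.
Proof.
move=> [Cy ymin] [Cz zmin].
have Cm : C (2^-1 *: (y + z)).
  by apply: closed_subspaceZ => //; apply: closed_subspaceD.
have := lerD (ymin _ Cm) (zmin _ Cm).
set m := `|x - 2^-1 *: (y + z)| ^+ 2 => ymz.
have par : `|y - z| ^+ 2 = (`|x - y| ^+ 2 + `|x - z| ^+ 2) *+ 2 - 4 * m.
  (* Parallelogram law for [x - y] and [x - z]. *)
  have -> : 4 * m = `|(x - y) + (x - z)| ^+ 2.
    have -> : (x - y) + (x - z) = 2 *: (x - 2^-1 *: (y + z)).
      rewrite scalerBr scalerA divff ?pnatr_eq0// scale1r.
      by rewrite scaler_nat mulr2n opprD addrACA.
    by rewrite normrZ exprMn normr_nat -natrX.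
  have -> : y - z = (x - z) - (x - y) by rewrite opprB [RHS]addrC addrA subrK.
  by rewrite (inner_normB (x - z)) (inner_normD (x - y)); ring.
rewrite par (_ : 4 * e = (m + e + (m + e)) *+ 2 - 4 * m); last by ring.
by rewrite lerD2r !mulr2n lerD.
Qed.

(** Moving [y] inside [C] along [w] to the point nearest [x] lowers the squared distance by
    [|'[x - y, w]|^2 / |w|^2], and no move within [C] gains more than [e]. *)
Let near_minimizers_orth x (e : K) y w : near_minimizers x e y -> C w ->
  `|'[x - y, w]| ^+ 2 <= e * `|w| ^+ 2.
Proof.
move=> [Cy ymin] Cw; have [->|w0] := eqVneq w 0.
  by rewrite (linear0r (inner H)) !normr0 expr0n mulr0.
rewrite -ler_pdivrMr ?exprn_gt0 ?normr_gt0//.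
have : C (y + ('[x - y, w] / `|w| ^+ 2) *: w).
  by apply: closed_subspaceD => //; apply: closed_subspaceZ.
move/ymin; rewrite opprD addrA norm_sub_inner_scale//.
by rewrite -addrA lerDl addrC subr_ge0.
Qed.

(** Near-minimizers form a Cauchy filter; its limit is in [C] by closedness, and the orthogonality
    defect tends to 0 along the filter. *)
Lemma orthoproj_exists x :
  exists y, C y /\ forall z, C z -> '[x - y, z] = 0.
Proof.
have FF := minimizing_filter x.
have : cauchy (minimizing x).
  apply: cauchy_exP => e /= e0.
  (* Any divisor above 4 works, as near-minimizers with tolerance [d] satisfy
     [|y - z|^2 <= 4 * d]. *)
  have d0 : 0 < e ^+ 2 / 5 by rewrite divr_gt0 ?exprn_gt0.
  have [y Gy] : near_minimizers x (e ^+ 2 / 5) !=set0.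
    by apply: (@filter_ex _ (minimizing x)); exists (e ^+ 2 / 5).
  exists y, (e ^+ 2 / 5) => // z Gz.
  rewrite -ball_normE /= -(@ltr_pXn2r _ 2) ?nnegrE ?(ltW e0)//.
  apply: le_lt_trans (near_minimizers_dist Gy Gz) _.
  by rewrite mulrCA gtr_pMr ?exprn_gt0// ltr_pdivrMr// mul1r ltr_nat.
move=> /cauchy_cvgP /cvg_ex [y xy]; exists y; split.
  apply: (@closed_cvg _ _ (minimizing x) _ id) xy; first by case: HC.
  by exists 1 => //= z [].
move=> w Cw.
have : '[x - z, w] @[z --> minimizing x] --> '[x - y, w].
  by apply: cvg_innerl; apply: cvgB => //; apply: cvg_cst.
move=> lim; apply: (cvg_unique _ lim); first exact: norm_hausdorff.
apply/cvgrPdist_lt => e e0; rewrite /=.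
(* The tolerance [e^2 / (|w|^2 + 1)], multiplied by [|w|^2], stays below [e^2], even for [w = 0]. *)
have w0 : 0 < `|w| ^+ 2 + 1 by rewrite ltr_wpDl// exprn_ge0.
exists (e ^+ 2 / (`|w| ^+ 2 + 1)) => [|z Gz] /=.
  by rewrite divr_gt0// exprn_gt0.
rewrite sub0r normrN -(@ltr_pXn2r _ 2) ?nnegrE ?(ltW e0)//.
apply: le_lt_trans (near_minimizers_orth Gz Cw) _.
by rewrite mulrAC ltr_pdivrMr// ltr_pM2l ?exprn_gt0// ltrDl.
Qed.

Lemma orthoprojP x :
  C (orthoproj C x) /\ forall z, C z -> '[x - orthoproj C x, z] = 0.
Proof. exact: (xgetPex 0 (orthoproj_exists x)). Qed.

Lemma orthoproj_mem x : C (orthoproj C x).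
Proof. by case: (orthoprojP x). Qed.

Lemma orthoproj_orth x z : C z -> '[x - orthoproj C x, z] = 0.
Proof. by case: (orthoprojP x) => _; apply. Qed.

Lemma orthoproj_unique x y : C y -> (forall z, C z -> '[x - y, z] = 0) ->
  orthoproj C x = y.
Proof.
move=> Cy xy; apply/eqP; rewrite -subr_eq0 -normr_eq0 -sqrf_eq0 inner_normE.
have Cd : C (orthoproj C x - y).
  by apply: closed_subspaceB => //; apply: orthoproj_mem.
(* A difference of two residuals orthogonal to [C] that itself lies in [C] is orthogonal to
   itself. *)
rewrite [X in '[X, _]](_ : _ = (x - y) - (x - orthoproj C x)).
  by rewrite innerBl xy// orthoproj_orth// subrr.
by rewrite opprB [RHS]addrC addrA subrK.
Qed.

Lemma orthoproj_id x : C x -> orthoproj C x = x.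
Proof. by move=> Cx; apply: orthoproj_unique => // z _; rewrite subrr (linear0l (inner H)). Qed.

Lemma orthoprojB x y : orthoproj C (x - y) = orthoproj C x - orthoproj C y.
Proof.
apply: orthoproj_unique => [|z Cz].
  by apply: closed_subspaceB => //; apply: orthoproj_mem.
by rewrite opprD addrACA -opprD innerBl !orthoproj_orth// subrr.
Qed.

Lemma inner_orthoprojl x z : C z -> '[orthoproj C x, z] = '[x, z].
Proof.
move=> Cz; apply/esym/eqP; rewrite -subr_eq0 -innerBl.
by rewrite orthoproj_orth.
Qed.

Lemma inner_orthoprojr x z : C z -> '[z, orthoproj C x] = '[z, x].
Proof. by move=> Cz; rewrite [LHS]innerC inner_orthoprojl// -innerC. Qed.

Lemma norm_orthoproj x :
  `|x| ^+ 2 = `|orthoproj C x| ^+ 2 + `|x - orthoproj C x| ^+ 2.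
Proof.
rewrite addrC -pythagoras ?subrK//.
by apply: orthoproj_orth; apply: orthoproj_mem.
Qed.

Lemma orthoproj_le x : `|orthoproj C x| <= `|x|.
Proof.
rewrite -(@ler_pXn2r _ 2) ?nnegrE// [leRHS]norm_orthoproj.
by rewrite lerDl exprn_ge0.
Qed.

(** By Pythagoras a projection that does not shorten [x] leaves no residual. This later puts the
    limit of the iterates in [B]. *)
Lemma norm_orthoproj_id x : `|x| <= `|orthoproj C x| -> orthoproj C x = x.
Proof.
move=> le; have : `|x - orthoproj C x| ^+ 2 <= 0.
  have := norm_orthoproj x => /eqP; rewrite addrC -subr_eq => /eqP <-.
  by rewrite subr_le0 lerXn2r ?nnegrE.
rewrite -[_ ^+ 2]ger0_norm ?exprn_ge0// normr_le0 sqrf_eq0 normr_eq0 subr_eq0.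
by move/eqP.
Qed.

End Projection.

(** * Alternating projections and von Neumann's theorem *)

Section AlternatingProjections.
Variables A B : set H.
Hypotheses (HA : closed_subspace A) (HB : closed_subspace B).
Local Notation P := (orthoproj A).
Local Notation Q := (orthoproj B).
Local Notation PQ := (orthoproj A \o orthoproj B).

Lemma iter_alternating_mem n a : A a -> A (iter n PQ a).
Proof. by case: n => [|n] //= _; apply: orthoproj_mem. Qed.

(** Against vectors of [A] the outer [P] disappears, and both sides equal ['[Q x, Q y]]. *)
Lemma alternating_selfadjoint x y : A x -> A y -> '[PQ x, y] = '[x, PQ y].
Proof.
move=> Ax Ay; rewrite /= (inner_orthoprojl HA)// (inner_orthoprojr HA)//.
have BQ := orthoproj_mem HB.
by rewrite -[LHS](inner_orthoprojr HB)// (inner_orthoprojl HB).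
Qed.

Lemma inner_iter_alternating a m n : A a ->
  '[iter m PQ a, iter n PQ a] = '[a, iter (m + n) PQ a].
Proof.
move=> Aa; elim: m n => [//|m IH] n; rewrite addSnnS -IH [iter m.+1 _ _]iterS.
by rewrite alternating_selfadjoint//; apply: iter_alternating_mem.
Qed.

(** The even-indexed values are the squared norms of the iterates, the odd-indexed ones those of
    their images under [Q]. Each step thus applies one more projection, which cannot increase the
    norm. *)
Lemma inner_iter_alternating_nonincreasing a m n : A a -> (m <= n)%N ->
  '[a, iter n PQ a] <= '[a, iter m PQ a].
Proof.
move=> Aa; elim: n => [|n IH]; first by rewrite leqn0 => /eqP ->.
rewrite leq_eqVlt => /predU1P[-> //|]; rewrite ltnS => /IH; apply: le_trans.
have even k : '[a, iter (k + k) PQ a] = `|iter k PQ a| ^+ 2.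
  by rewrite -inner_iter_alternating// inner_normE.
have odd k : '[a, iter (k + k.+1) PQ a] = `|Q (iter k PQ a)| ^+ 2.
  rewrite -inner_iter_alternating// iterS /= inner_orthoprojr//.
    by rewrite inner_normE inner_orthoprojl//; apply: orthoproj_mem.
  exact: iter_alternating_mem.
have [k [->|->]] : exists k, n = (k + k)%N \/ n = (k + k.+1)%N.
  exists n./2; have := odd_double_half n; rewrite -addnn addnS.
  by case: (ssrnat.odd n) => /esym; [right|left].
- rewrite -addnS odd even ler_pXn2r ?nnegrE//; exact: orthoproj_le.
- rewrite -addSn even odd ler_pXn2r ?nnegrE//; exact: orthoproj_le.
Qed.

(** With [c k = '[a, iter k PQ a]], the right side minus the left is [2 * (c (m + n) - c (n + n))],
    nonnegative by monotonicity. *)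
Lemma iter_alternating_dist a m n : A a -> (m <= n)%N ->
  `|iter m PQ a - iter n PQ a| ^+ 2
  <= `|iter m PQ a| ^+ 2 - `|iter n PQ a| ^+ 2.
Proof.
move=> Aa mn; rewrite inner_normB !inner_normE !inner_iter_alternating//.
have : '[a, iter (n + n) PQ a] <= '[a, iter (m + n) PQ a].
  by apply: inner_iter_alternating_nonincreasing; rewrite ?leq_add2r.
rewrite (addnC n m) -addrA lerD2l; set s := inner H _ _; set t := inner H _ _.
move=> st; rewrite -subr_ge0 (_ : _ - _ = (t - s) + (t - s)); last by ring.
by rewrite addr_ge0// subr_ge0.
Qed.

Theorem von_neumann_alternating_projections a : A a ->
  iter n PQ a @[n --> \oo] --> orthoproj (A `&` B) a.
Proof.
move=> Aa; pose e n := iter n PQ a.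
have : cauchy (e n @[n --> \oo]).
  apply: cauchy_exP => eps eps0.
  (* Choose [N] with [|e N|^2] within [eps^2 / 2] of every [|e n|^2]; the distance bound then keeps
     all later iterates within [eps] of [e N]. *)
  have [|||s [N _ <-] Nmin] := scalar_inf_adherent scalars
      (S := range (fun n => `|e n| ^+ 2)) (e := eps ^+ 2 / 2).
  - by exists (`|e 0%N| ^+ 2), 0%N.
  - by move=> _ [n _ <-]; rewrite exprn_ge0.
  - by rewrite divr_gt0// exprn_gt0.
  exists (e N), N => // n /= Nn.
  rewrite -ball_normE /= -(@ltr_pXn2r _ 2) ?nnegrE ?(ltW eps0)//.
  apply: le_lt_trans (iter_alternating_dist Aa Nn) _.
  rewrite ltrBlDl; apply: le_lt_trans (Nmin (`|e n| ^+ 2) _) _; first by exists n.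
  by rewrite ltrD2l ltr_pdivrMr// ltr_pMr ?exprn_gt0// ltr1n.
move=> /cauchy_cvgP /cvg_ex [z ez].
have Az : A z.
  apply: (closed_cvg _ _ _ _ ez); first by case: HA.
  by apply: nearW => n; apply: iter_alternating_mem.
(* [PQ] does not increase distances, so [PQ (e n)], which is the shifted sequence, tends to both
   [PQ z] and [z]. *)
have fix_z : PQ z = z.
  have : PQ (e n) @[n --> \oo] --> PQ z.
    apply/cvgrPdist_lt => eps eps0; move/cvgrPdist_lt : ez => /(_ _ eps0).
    apply: filterS => n; apply: le_lt_trans.
    rewrite /= -!orthoprojB//; apply: le_trans (orthoproj_le _ _) _ => //.
    exact: orthoproj_le.
  move=> ePQ; apply: (cvg_unique _ ePQ); first exact: norm_hausdorff.
  by rewrite -(cvg_shiftS e) in ez.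
(* From [z = P (Q z)] follows [|z| <= |Q z|], hence [Q z = z]. *)
have Bz : B z.
  rewrite -(@norm_orthoproj_id B HB z); first exact: orthoproj_mem.
  by rewrite -{1}fix_z; apply: orthoproj_le.
suff -> : orthoproj (A `&` B) a = z by [].
apply: orthoproj_unique => //; first exact: closed_subspaceI.
move=> w [Aw Bw].
(* Neither projection changes the inner product with a vector of both [A] and [B]. *)
have ew n : '[a - e n, w] = 0.
  rewrite innerBl; apply/eqP; rewrite subr_eq0; apply/eqP.
  elim: n => [//|n ->]; rewrite /e iterS /=.
  by rewrite !inner_orthoprojl.
have : '[a - e n, w] @[n --> \oo] --> '[a - z, w].
  by apply: cvg_innerl; apply: cvgB => //; apply: cvg_cst.
under eq_fun do rewrite ew.
move=> lim; apply: (cvg_unique _ lim); first exact: norm_hausdorff.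
exact: cvg_cst.
Qed.

(** For [e] in [A], [orthoprojC A (orthoprojC B e)] is [(e - Q e) - (e - P (Q e))]. Applying
    [orthoprojC B] cancels everything except [orthoprojC B (P (Q e))]. *)
Lemma iter_complement_alternating k a : A a ->
  orthoprojC B (iter k (orthoprojC A \o orthoprojC B) a)
  = orthoprojC B (iter k PQ a).
Proof.
move=> Aa; have QB x y : orthoprojC B (x - y) = orthoprojC B x - orthoprojC B y.
  by rewrite /orthoprojC orthoprojB// opprD addrACA -opprD.
have QQ x : orthoprojC B (x - Q x) = orthoprojC B x.
  by rewrite QB {2}/orthoprojC (orthoproj_id HB (orthoproj_mem HB x)) subrr subr0.
elim: k => [//|k IH]; rewrite [in LHS]iterS /= IH.
have /(orthoproj_id HA) := iter_alternating_mem k Aa.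
move: (iter k PQ a) => e Pe.
have -> : orthoprojC A (orthoprojC B e) = (e - Q e) - (e - P (Q e)).
  by rewrite /orthoprojC (orthoprojB HA) Pe.
by rewrite QB QQ QB subKr.
Qed.

(** Subtracting the [orthoprojC A] part of a vector leaves its [P] part, and
    [P (e - Q e) = e - P (Q e)] for [e] in [A]. *)
Lemma complement_alternating_term k a : A a ->
  orthoprojC B (iter k (orthoprojC A \o orthoprojC B) a)
    - iter k.+1 (orthoprojC A \o orthoprojC B) a
  = iter k PQ a - iter k.+1 PQ a.
Proof.
move=> Aa; rewrite !iterS /= iter_complement_alternating//.
have /(orthoproj_id HA) := iter_alternating_mem k Aa.
move: (iter k PQ a) => e Pe.
by rewrite [orthoprojC A _]/orthoprojC subKr /orthoprojC (orthoprojB HA) Pe.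
Qed.

End AlternatingProjections.

End InnerProduct.

(** * Telescoping and the three formulas *)

Lemma series_telescope (V : zmodType) (f : nat -> V) n :
  series (fun k => f k - f k.+1) n = f 0%N - f n.
Proof.
rewrite /series /= -opprB -(telescope_sumr _ (leq0n n)) -sumrN.
by apply: eq_bigr => k _; rewrite opprB.
Qed.

Unset Implicit Arguments.
Set Strict Implicit.

Theorem theorem3p2 (R : realType) (K : numFieldType) (conj : K -> K)
    (scalars : @real_or_complex R K conj) (H : hilbert conj) (A B : set H)
    (A_closed : closed_subspace A) (B_closed : closed_subspace B) :
  let PA' := orthoprojC A in
  let PB' := orthoprojC B in
  let PAB' := orthoprojC (A `&` B) in
  [/\ forall a : H, A a ->
        series (fun k : nat => PB' (iter k (PA' \o PB') a)
                               - iter k.+1 (PA' \o PB') a) @ \oo --> PAB' a,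
      forall a1 a2 : H, A a1 -> A a2 ->
        series (fun k : nat => inner H (PB' (iter k (PA' \o PB') a1)) a2) @ \oo
          --> inner H (PAB' a1) (PAB' a2)
    & forall a b : H, A a -> B b ->
        (fun n : nat =>
           - series (fun k : nat => inner H (iter k.+1 (PA' \o PB') a) b) n)
          @ \oo --> inner H (PAB' a) (PAB' b)].
Proof.
move=> PA' PB' PAB'.
pose e a n := iter n (orthoproj A \o orthoproj B) a.
have termE a k : A a ->
    PB' (iter k (PA' \o PB') a) - iter k.+1 (PA' \o PB') a = e a k - e a k.+1.
  exact: (complement_alternating_term scalars A_closed B_closed).
have e_cvg a : A a -> e a n @[n --> \oo] --> orthoproj (A `&` B) a.
  exact: (von_neumann_alternating_projections scalars A_closed B_closed).
have AB_closed : closed_subspace (A `&` B) by exact: closed_subspaceI.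
(* The dropped part [orthoproj (A]&[B) x] is orthogonal to [PAB' a]. *)
have PAB'_innerr a x : inner H (PAB' a) (PAB' x) = inner H (PAB' a) x.
  rewrite innerBr [X in _ - X](orthoproj_orth scalars) ?subr0//.
  exact: (orthoproj_mem scalars).
have inner_cvg a x : A a ->
    inner H a x - inner H (e a n) x @[n --> \oo] --> inner H (PAB' a) x.
  move=> Aa; under eq_fun do rewrite -innerBl.
  apply: (cvg_innerl scalars); apply: cvgB; first exact: cvg_cst.
  exact: e_cvg.
split=> [a Aa|a1 a2 Aa1 Aa2|a b Aa Bb].
- under eq_fun do rewrite termE//.
  rewrite (_ : series _ = fun n => a - e a n); last first.
    by apply/funext => n; rewrite series_telescope.
  by apply: cvgB; [exact: cvg_cst|exact: e_cvg].
- rewrite PAB'_innerr (_ : series _ = fun n => inner H a1 a2 - inner H (e a1 n) a2).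
    exact: inner_cvg.
  apply/funext => n; rewrite -(series_telescope (fun k => inner H (e a1 k) a2)).
  congr series; apply/funext => k; rewrite -innerBl -termE// innerBl.
  (* The subtracted iterate is a value of [PA'], hence orthogonal to [a2]. *)
  by rewrite iterS [X in _ - X](orthoproj_orth scalars) ?subr0.
- rewrite PAB'_innerr (_ : (fun _ => _) = fun n => inner H a b - inner H (e a n) b).
    exact: inner_cvg.
  apply/funext => n; rewrite -[RHS]opprK opprB addrC -[in RHS](opprK (inner H (e a n) b)).
  (* The terms lack the minus sign of the first formula, so the negated sequence telescopes. *)
  rewrite -(series_telescope (fun k => - inner H (e a k) b)); congr (- series _ _).
  apply/funext => k; rewrite opprK addrC -[RHS]opprB -innerBl -termE// innerBl.
  (* The [PB'] part of the term vanishes against [b] in [B]. *)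
  by rewrite [X in X - _](orthoproj_orth scalars) ?sub0r ?opprK.
Qed.
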